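(* Let $X=(X_1,\dots,X_d)$ and $Y=(Y_1,\dots,Y_d)$ be random vectors in $\mathbb{R}^d$ with $X_i\ge 0$, $Y_i\ge 0$ and $\mathrm{E}(X_i)<\infty$, $\mathrm{E}(Y_i)<\infty$ for all $i\in\{1,\dots,d\}$. If for each $x=(x_1,\dots,x_d)\in\mathbb{R}^d$ with $x_i>0$ for all $i$ we have $$\mathrm{E}\{\max(1,x_1X_1,\dots,x_dX_d)\}=\mathrm{E}\{\max(1,x_1Y_1,\dots,x_dY_d)\},$$ then $X$ and $Y$ have the same distribution.
   Context: $d\ge 1$ is an integer. $\mathrm{E}$ denotes expectation. *)

(* Defs.v *)
From HB Require Import structures.
From mathcomp Require Export all_boot all_order all_algebra.
From mathcomp Require Export all_classical all_reals all_analysis.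

Set Implicit Arguments.
Unset Strict Implicit.
Unset Printing Implicit Defensive.

Import Order.TTheory GRing.Theory Num.Theory.

Local Open Scope classical_set_scope.
Local Open Scope ring_scope.

(* The library's measures are total functions on [set T] whose values are
   unconstrained outside the sigma-algebra, so equality of laws has to be
   restricted to measurable sets. *)
Definition same_distribution (dP dQ dE : measure_display)
    (S : measurableType dP) (T : measurableType dQ) (E : measurableType dE)
    (R : realType) (P : probability S R) (Q : probability T R)
    (X : {RV P >-> E}) (Y : {RV Q >-> E}) : Prop :=
  forall A : set E, measurable A -> distribution P X A = distribution Q Y A.

(* R^d is [d.-tuple R]: its sigma-algebra is the one generated by the
   coordinates [tnth ^~ i], R carrying its Borel sigma-algebra; it is the Borel
   sigma-algebra of R^d. *)
Definition component (dP : measure_display) (S : measurableType dP)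
    (R : realType) (P : probability S R) (d : nat)
    (X : {RV P >-> d.-tuple R}) (i : 'I_d) : S -> R :=
  fun w => tnth (X w) i.

(* The value 1 in max(1, x_1 X_1, ..., x_d X_d) is the initial value of the
   iterated maximum. *)
Definition scaled_max (dP : measure_display) (S : measurableType dP)
    (R : realType) (P : probability S R) (d : nat)
    (X : {RV P >-> d.-tuple R}) (x : d.-tuple R) : S -> R :=
  fun w => \big[Num.max/1]_(i < d) (tnth x i * component X i w).

(* Main.v *)
Require Import Defs.
From mathcomp Require Import all_boot all_order all_algebra.
From mathcomp Require Import all_classical all_reals all_analysis.
From mathcomp Require Import measurable_realfun ring lra.

Set Implicit Arguments.
Unset Strict Implicit.
Unset Printing Implicit Defensive.

Import Order.TTheory GRing.Theory Num.Theory.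
Import numFieldNormedType.Exports.

Local Open Scope classical_set_scope.
Local Open Scope ring_scope.

(** Write G_x = max(1, x_1 X_1, ..., x_d X_d). A probability on R^d is
    determined by its joint distribution function
    a |-> P(X_1 <= a_1, ..., X_d <= a_d), because the orthants
    prod_i ]-oo, a_i] form a pi-system generating the Borel sets
    ([finite_measure_unique_orthant]). So it suffices to recover this function
    from x |-> E G_x, x > 0.

    If some a_i < 0 then it vanishes, as X_i >= 0 almost surely. Otherwise, for
    s > 0,
      (1 + s) G_{x / (1 + s)} = max(1 + s, x_1 X_1, ..., x_d X_d)
                              = max(1 + s, G_x),
    hence the difference quotient in the threshold,
      ((1 + s) G_{x / (1 + s)} - G_x) / s = max(1 - (G_x - 1) / s, 0),
    is a function with values in [0, 1], equal to 1 where G_x <= 1 and to 0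
    where G_x >= 1 + s; its expectation is determined by the values of E G
    ([expectation_tent]), which are finite since the X_i are integrable. Along
    s = u_n and x_i = 1 / (a_i + u_n) with u_n = 1 / (n + 1), these functions
    converge everywhere to the indicator of {X_1 <= a_1, ..., X_d <= a_d}
    ([tent_cvg_orthant]), so by dominated convergence their expectations
    converge to the joint distribution function at a. Adding u_n to a_i keeps
    the weights x_i positive and finite, which covers the boundary case a_i = 0
    along with a_i > 0. *)

(** * Orthants determine finite measures on R^d *)

Definition orthant (R : realType) (d : nat) (a : d.-tuple R) :
    set (d.-tuple R) :=
  [set t | forall i, tnth t i <= tnth a i].

Lemma orthant_preimageE (R : realType) (d : nat) (a : d.-tuple R) :
  orthant a =
  \bigcap_(i in [set: 'I_d]) ((@tnth d R ^~ i) @^-1` `]-oo, tnth a i]).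
Proof.
apply/seteqP; split=> t /= h i; first by move=> _; rewrite /= in_itv/=.
by have := h i I; rewrite /= in_itv.
Qed.

Lemma measurable_orthant (R : realType) (d : nat) (a : d.-tuple R) :
  measurable (orthant a).
Proof.
rewrite orthant_preimageE; apply: fin_bigcap_measurable => // i _.
by rewrite -[X in measurable X]setTI; exact: measurable_tnth.
Qed.

Lemma orthantI (R : realType) (d : nat) (a b : d.-tuple R) :
  orthant a `&` orthant b =
  orthant [tuple Num.min (tnth a i) (tnth b i) | i < d].
Proof.
apply/seteqP; split=> [t [/= ta tb] i|t /= tab].
  by rewrite tnth_mktuple le_min ta tb.
by split=> i; have := tab i; rewrite tnth_mktuple le_min => /andP[].
Qed.

Lemma bounded_coordinates (R : realType) (d : nat) (t : d.-tuple R) :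
  exists n : nat, forall i, tnth t i <= n%:R.
Proof.
exists (\max_(i < d) Num.bound `|tnth t i|)%N => i.
rewrite (le_trans (ler_norm _))// (le_trans (ltW (archi_boundP _)))//.
by rewrite ler_nat (leq_bigmax i).
Qed.

(** It is enough that the identity, from R^d with the sigma-algebra generated by
    the orthants, be measurable, which is checked on each coordinate and each
    ray. The half-space t_i <= r is the countable union over n of the orthants
    with bound r on coordinate i and n on all the others. *)
Lemma measurable_sub_orthants (R : realType) (d : nat) :
  @measurable _ (d.-tuple R) `<=` <<s range (@orthant R d) >>.
Proof.
pose G := range (@orthant R d).
suff mid : measurable_fun [set: g_sigma_algebraType G]
    (id : g_sigma_algebraType G -> d.-tuple R).
  by move=> A mA; have := mid measurableT A mA; rewrite setTI.
apply/measurable_fun_tnthP => i.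
move=> mT; apply: (measurability _ (RGenOInfty.measurableE R)) => //.
move=> _ [_ [r ->] <-]; rewrite setTI -setCitvl preimage_setC.
apply: measurableC.
rewrite [X in measurable X](_ : _ = \bigcup_n
    orthant [tuple if j == i then r else n%:R | j < d]); last first.
  apply/seteqP; split=> [t /=|t [n _ /= /(_ i)]]; rewrite in_itv/=; last first.
    by rewrite tnth_mktuple eqxx.
  move=> tr; have [n tn] := bounded_coordinates t.
  by exists n => // j; rewrite tnth_mktuple; case: eqP => [->|].
by apply: bigcupT_measurable => n; apply: sub_sigma_algebra; eexists.
Qed.

Lemma finite_measure_unique_orthant (R : realType) (d : nat)
    (m1 m2 : {finite_measure set (d.-tuple R) -> \bar R}) :
  (forall a, m1 (orthant a) = m2 (orthant a)) ->
  forall A, measurable A -> m1 A = m2 A.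
Proof.
move=> m12 A /measurable_sub_orthants.
apply: (g_sigma_algebra_measure_unique _ _
  (fun n => orthant [tuple n%:R | i < d])).
- by move=> _ [a _ <-]; exact: measurable_orthant.
- by move=> n; eexists.
- rewrite -subTset => t _; have [n tn] := bounded_coordinates t.
  by exists n => // i; rewrite tnth_mktuple.
- by move=> _ _ [a _ <-] [b _ <-]; rewrite orthantI; eexists.
- by move=> _ [a _ <-]; exact: m12.
- by move=> n; rewrite -ge0_fin_numE// fin_num_measure//;
    exact: measurable_orthant.
Qed.

(** * From expectations of maxima to orthant probabilities *)

(** Homogeneity of the maximum: multiplying by c turns the threshold 1 into c,
    and c >= 1 absorbs the threshold 1 that remains on the right. *)
Lemma bigmax1_rescale (R : realFieldType) (d : nat) (c : R) (y : 'I_d -> R) :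
  1 <= c ->
  c * \big[Num.max/1]_(i < d) (y i / c) =
  Num.max c (\big[Num.max/1]_(i < d) y i).
Proof.
move=> c1; have c0 : 0 < c by lra.
apply: le_anti; apply/andP; split.
  rewrite -(ler_pdivlMl _ _ c0); apply/bigmax_leP; split=> [|i _].
    by rewrite ler_pdivlMl// mulr1 le_max lexx.
  by rewrite mulrC ler_pM2l ?invr_gt0// le_max le_bigmax orbT.
have lec : c <= c * \big[Num.max/1]_(i < d) (y i / c).
  by apply: ler_peMr; [exact: ltW | exact: bigmax_ge_id].
rewrite ge_max lec; apply/bigmax_leP; split=> [|i _]; first exact: le_trans lec.
by rewrite -ler_pdivrMl// mulrC (le_bigmax _ (fun i => y i / c)).
Qed.

Definition shrink (R : realType) (d : nat) (c : R) (x : d.-tuple R) :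
    d.-tuple R :=
  [tuple tnth x i / c | i < d].

(** With these weights, for a_i >= 0, the scaled maximum of X exceeds 1 exactly
    when X_i > a_i + 1 / (n + 1) for some i. *)
Definition upper_scale (R : realType) (d : nat) (a : d.-tuple R) (n : nat) :
    d.-tuple R :=
  [tuple (tnth a i + harmonic n)^-1 | i < d].

Section tent.
Context (R : realType) (d : nat) (dP : measure_display).
Context (S : measurableType dP) (P : probability S R).
Variable X : {RV P >-> d.-tuple R}.

Lemma scaled_max_ge1 (x : d.-tuple R) w : 1 <= scaled_max X x w.
Proof. exact: bigmax_ge_id. Qed.

Lemma measurable_component i : measurable_fun setT (component X i).
Proof. exact: (measurableT_comp (measurable_tnth i)). Qed.

Lemma measurable_scaled_max (x : d.-tuple R) :
  measurable_fun setT (scaled_max X x).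
Proof.
rewrite /scaled_max; elim: (index_enum _) => [|i r IHr].
  by under eq_fun do rewrite big_nil; exact: measurable_cst.
under eq_fun do rewrite big_cons; apply: measurable_maxr => //.
by apply: measurable_funM => //; exact: measurable_component.
Qed.

Lemma scaled_max_rescale (s : R) (x : d.-tuple R) w : 0 <= s ->
  (1 + s) * scaled_max X (shrink (1 + s) x) w =
  Num.max (1 + s) (scaled_max X x w).
Proof.
move=> s0; rewrite /scaled_max -bigmax1_rescale; last by lra.
by congr (_ * _); apply: eq_bigr => i _; rewrite tnth_mktuple mulrAC.
Qed.

(** The difference quotient over [1, 1 + s] of t |-> max(t, G), where G is the
    scaled maximum: a piecewise linear approximation of the indicator of
    G <= 1. *)
Definition tent (s : R) (x : d.-tuple R) (w : S) : R :=
  Num.max (1 - (scaled_max X x w - 1) / s) 0.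

Lemma measurable_tent s x : measurable_fun setT (tent s x).
Proof.
apply: measurable_maxr => //; apply: measurable_funB => //.
by apply: measurable_funM => //; apply: measurable_funB => //;
  exact: measurable_scaled_max.
Qed.

Lemma tent_itv01 s x w : 0 < s -> 0 <= tent s x w <= 1.
Proof.
move=> s0; rewrite /tent le_max lexx orbT ge_max ler01 andbT/=.
rewrite gerBl; apply: divr_ge0; last exact: ltW.
by rewrite subr_ge0 scaled_max_ge1.
Qed.

Lemma tentE s x w : 0 < s ->
  tent s x w =
  s^-1 * ((1 + s) * scaled_max X (shrink (1 + s) x) w
          - scaled_max X x w).
Proof.
move=> s0; rewrite scaled_max_rescale ?ltW// /tent.
rewrite addr_maxl subrr maxr_pMr ?invr_ge0 ?ltW// mulr0; congr Num.max.
by field; rewrite gt_eqF.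
Qed.

(** On the orthant the scaled maximum is 1 for all n. Off the orthant, some
    X_i > a_i, and (a_i + u_n) (1 + u_n) tends to a_i, so eventually X_i exceeds
    it; the scaled maximum is then at least 1 + u_n and the tent vanishes. In
    both cases the sequence is eventually constant. *)
Lemma tent_cvg_orthant (a : d.-tuple R) w : (forall i, 0 <= tnth a i) ->
  tent (harmonic n) (upper_scale a n) w
    @[n --> \oo] --> (\1_(X @^-1` orthant a) w : R).
Proof.
move=> a0; have u0 n : 0 < harmonic n :> R by rewrite /= invr_gt0.
rewrite indicE; have [Xa|/negP Xa] := boolP (w \in _).
  move: Xa; rewrite inE /= => Xa.
  rewrite [X in X @ _](_ : _ = cst 1); first exact: cvg_cst.
  apply/funext => n; rewrite /tent (_ : scaled_max _ _ _ = 1).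
    by rewrite subrr mul0r subr0; apply/max_idPl.
  apply/eqP; rewrite eq_le scaled_max_ge1 andbT.
  apply/bigmax_leP; split=> // i _; rewrite tnth_mktuple.
  rewrite ler_pdivrMl ?mulr1 ?ltr_wpDl//.
  by rewrite (le_trans (Xa i))// lerDl ltW.
have [i ai] : exists i, tnth a i < component X i w.
  apply: contrapT => /forallNP h; apply: Xa; rewrite inE => i.
  by rewrite leNgt; apply/negP; exact: h.
have hc : (tnth a i + harmonic n) * (1 + harmonic n)
    @[n --> \oo] --> tnth a i.
  have : (tnth a i + harmonic n) * (1 + harmonic n)
      @[n --> \oo] --> (tnth a i + 0) * (1 + 0).
    by apply: cvgM; apply: cvgD; (exact: cvg_cst || exact: cvg_harmonic).
  by rewrite !addr0 mulr1.
have hlt := cvgr_lt _ hc _ ai.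
apply: cvg_near_cst; near=> n.
have hn : (tnth a i + harmonic n) * (1 + harmonic n) < component X i w.
  by near: n; exact: hlt.
apply/max_idPr; rewrite subr_le0 ler_pdivlMr// mul1r lerBrDl.
apply: (le_trans _ (le_bigmax _ _ i)); rewrite tnth_mktuple.
by rewrite ler_pdivlMl ?ltr_wpDl// ltW.
Unshelve. all: by end_near.
Qed.

Lemma expectation_tent_cvg (a : d.-tuple R) : (forall i, 0 <= tnth a i) ->
  'E_P[tent (harmonic n) (upper_scale a n)]%E
    @[n --> \oo] --> distribution P X (orthant a).
Proof.
move=> a0; have mA : measurable (X @^-1` orthant a).
  exact: measurable_funPTI (measurable_orthant a).
have <- : 'E_P[\1_(X @^-1` orthant a)]%E = distribution P X (orthant a).
  exact: expectation_indic.
rewrite unlock; have [] := @dominated_convergence _ _ _ P setT measurableT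
  (fun n w => (tent (harmonic n) (upper_scale a n) w)%:E)
  (fun w => (\1_(X @^-1` orthant a) w)%:E) (EFin \o cst 1) => //.
- by move=> n; apply/measurable_EFinP; exact: measurable_tent.
- by apply/measurable_EFinP; exact: measurable_indic.
- apply: aeW => w _; apply: cvg_EFin; first exact: nearW.
  exact: tent_cvg_orthant.
- exact: finite_measure_integrable_cst.
- apply: aeW => w n _; rewrite lee_fin.
  have u0 : 0 < harmonic n :> R by rewrite /= invr_gt0.
  by have /andP[t0 t1] := tent_itv01 (upper_scale a n) w u0;
    rewrite ger0_norm.
Qed.

Hypothesis X_ge0 : forall i, {ae P, forall w, 0 <= component X i w}.

Lemma distribution_orthant_lt0 (a : d.-tuple R) i : tnth a i < 0 ->
  distribution P X (orthant a) = 0%E.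
Proof.
move=> ai; have [N [mN PN0 XN]] := X_ge0 i.
have mA : measurable (X @^-1` orthant a).
  exact: measurable_funPTI (measurable_orthant a).
apply: (subset_measure0 mA mN _ PN0) => w Xa; apply: XN => /= Xi0.
by have := le_lt_trans (Xa i) ai; rewrite ltNge Xi0.
Qed.

Hypothesis EX_fin : forall i, ('E_P[component X i] < +oo)%E.

Lemma integrable_component i : P.-integrable setT (EFin \o component X i).
Proof.
have mX := measurable_component i.
apply/integrableP; split; first exact/measurable_EFinP.
move: (EX_fin i); rewrite unlock; apply: le_lt_trans.
rewrite le_eqVlt; apply/orP; left; apply/eqP; apply: ae_eq_integral => //.
- by apply: measurableT_comp => //; exact/measurable_EFinP.
- exact/measurable_EFinP.
- by apply: filterS (X_ge0 i) => w Xi0 _ /=; rewrite ger0_norm.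
Qed.

(** Domination: the scaled maximum lies between 1 and 1 + sum_i |x_i X_i|. *)
Lemma integrable_scaled_max x : P.-integrable setT (EFin \o scaled_max X x).
Proof.
pose bound (w : S) := (1 + \sum_(i < d) `|tnth x i * component X i w|%:E)%E.
apply: (@le_integrable _ _ _ _ _ measurableT _ bound) => //.
- by apply/measurable_EFinP; exact: measurable_scaled_max.
- move=> w _; rewrite /bound /= sumEFin lee_fin !ger0_norm.
  + apply/bigmax_leP; split=> [|i _]; first by rewrite lerDl sumr_ge0.
    rewrite (bigD1 i)//= (le_trans (ler_norm _))// addrCA lerDl.
    by rewrite addr_ge0// sumr_ge0.
  + by rewrite (le_trans _ (scaled_max_ge1 _ _)).
  + by rewrite addr_ge0// sumr_ge0.
apply: integrableD => //; first exact: finite_measure_integrable_cst.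
apply: integrable_sum => // i _.
have iXi : P.-integrable setT
    (fun w => (tnth x i)%:E * (component X i w)%:E)%E.
  by apply: integrableZl => //; exact: integrable_component.
exact: (integrable_abse iXi).
Qed.

(** Finiteness of the expectations of the scaled maxima is what allows the
    difference quotient to be integrated term by term. *)
Lemma expectation_tent s x : 0 < s ->
  'E_P[tent s x]%E =
  (s^-1%:E * ((1 + s)%:E *
     'E_P[scaled_max X (shrink (1 + s) x)] - 'E_P[scaled_max X x]))%E.
Proof.
move=> s0; rewrite unlock.
under eq_integral do rewrite tentE// EFinM EFinB EFinM.
have iy y : P.-integrable setT (fun w => (scaled_max X y w)%:E).
  exact: integrable_scaled_max.
have iZ k y : P.-integrable setT (fun w => k%:E * (scaled_max X y w)%:E)%E.
  exact: integrableZl.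
rewrite integralZl//; last exact: integrableB.
by rewrite integralB// integralZl.
Qed.

End tent.

Theorem lemma1p1 (R : realType) (d : nat) (hd : (1 <= d)%N)
    (dP dQ : measure_display) (S : measurableType dP) (T : measurableType dQ)
    (P : probability S R) (Q : probability T R)
    (X : {RV P >-> d.-tuple R}) (Y : {RV Q >-> d.-tuple R})
    (X_ge0 : forall i : 'I_d, {ae P, forall w, 0 <= component X i w})
    (Y_ge0 : forall i : 'I_d, {ae Q, forall w, 0 <= component Y i w})
    (EX_fin : forall i : 'I_d, ('E_P[component X i] < +oo)%E)
    (EY_fin : forall i : 'I_d, ('E_Q[component Y i] < +oo)%E)
    (Emax : forall x : d.-tuple R, (forall i : 'I_d, 0 < tnth x i) ->
       'E_P[scaled_max X x]%E = 'E_Q[scaled_max Y x]%E) :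
  same_distribution X Y.
Proof.
apply: finite_measure_unique_orthant => a.
have [[i ai]|/forallNP a0] := pselect (exists i, tnth a i < 0).
  exact: etrans (distribution_orthant_lt0 X_ge0 ai)
    (esym (distribution_orthant_lt0 Y_ge0 ai)).
have {}a0 i : 0 <= tnth a i by rewrite leNgt; apply/negP; exact: a0.
have cX := expectation_tent_cvg (X := X) a0.
have cY := expectation_tent_cvg (X := Y) a0.
have tentXY n : 'E_P[tent X (harmonic n) (upper_scale a n)]%E =
    'E_Q[tent Y (harmonic n) (upper_scale a n)]%E.
  have u0 : 0 < harmonic n :> R by rewrite /= invr_gt0.
  have x0 i : 0 < tnth (upper_scale a n) i.
    by rewrite tnth_mktuple invr_gt0 ltr_wpDl.
  rewrite !expectation_tent// !Emax// => i.
  by rewrite tnth_mktuple divr_gt0// addr_gt0.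
move: cX; rewrite (eq_cvg _ _ tentXY) => cX.
exact: (cvg_unique _ cX cY).
Qed.
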